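(* Let $1\le p<\infty$, let $E$ and $F$ be Banach spaces, and let $T\colon\mathrm{FBL}^p[E]\to\mathrm{FBL}^p[F]$ be a lattice homomorphism. Then there is a unique map $\Phi_T\colon F^*\to E^*$ such that $$Tf=f\circ\Phi_T\qquad(f\in\mathrm{FBL}^p[E]).$$ This map $\Phi_T$ is positively homogeneous and satisfies (i) $\|\Phi_T\|_p=\|T\|$; (ii) $\Phi_T|_{B_{F^*}}$ is weak*-to-weak* continuous.
   Context: All Banach spaces are real. For a Banach space $E$ with dual $E^*$, $B_{E^*}$ is the closed unit ball of $E^*$. A map $f$ from $E^*$ to a real vector space is positively homogeneous if $f(\lambda x^* )=\lambda f(x^* )$ for all $x^*\in E^*$ and $\lambda\in[0,\infty)$. $H[E]$ is the vector lattice of all positively homogeneous functions $E^*\to\mathbb{R}$ with pointwise operations. For $x\in E$, $\delta_x\in H[E]$ is $\delta_x(x^* )=x^*(x)$. For $x_1^*,\dots,x_n^*\in E^*$, set $\|(x_j^* )_{j=1}^n\|_{p,\mathrm{weak}}=\sup_{\|x\|\le1}\bigl(\sum_{j=1}^n|x_j^*(x)|^p\bigr)^{1/p}$, and for $f\in H[E]$ set $\|f\|_{\mathrm{FBL}^p[E]}=\sup\bigl\{\bigl(\sum_{j=1}^n|f(x_j^* )|^p\bigr)^{1/p}: n\in\mathbb{N},\ (x_j^* )_{j=1}^n\subset E^*,\ \|(x_j^* )_{j=1}^n\|_{p,\mathrm{weak}}\le1\bigr\}\in[0,\infty]$. $H^p[E]=\{f\in H[E]:\|f\|_{\mathrm{FBL}^p[E]}<\infty\}$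 is a Banach lattice in the norm $\|\cdot\|_{\mathrm{FBL}^p[E]}$, and $\mathrm{FBL}^p[E]$ is the closed sublattice of $H^p[E]$ generated by $\{\delta_x:x\in E\}$. A lattice homomorphism is a linear map preserving the lattice operations; $\|T\|$ is the operator norm of $T$ with respect to the norms $\|\cdot\|_{\mathrm{FBL}^p[E]}$ and $\|\cdot\|_{\mathrm{FBL}^p[F]}$. For a positively homogeneous map $\Phi\colon F^*\to E^*$, set $\|\Phi\|_p=\sup\bigl\{\|(\Phi(y_j^* ))_{j=1}^m\|_{p,\mathrm{weak}}: m\in\mathbb{N},\ (y_j^* )_{j=1}^m\subset F^*,\ \|(y_j^* )_{j=1}^m\|_{p,\mathrm{weak}}\le1\bigr\}\in[0,\infty]$. *)

(* Defs.v *)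
From HB Require Import structures.
From mathcomp Require Import all_boot all_order all_algebra.
From mathcomp Require Import all_classical all_reals all_analysis.

Set Implicit Arguments.
Unset Strict Implicit.
Unset Printing Implicit Defensive.

Import Order.TTheory GRing.Theory Num.Theory.
Import numFieldNormedType.Exports.

Local Open Scope classical_set_scope.
Local Open Scope ring_scope.

(* N and M are norms with values in [0, +oo]; the result is +oo when T is
   unbounded. *)
Definition opnorm {R : realType} {V W : Type} (N : V -> \bar R)
    (M : W -> \bar R) (T : V -> W) : \bar R :=
  ereal_sup [set M (T v) | v in [set v | (N v <= 1)%E]].

Definition pos_homogeneous {R : realType} {V W : lmodType R} (f : V -> W) :=
  forall (l : R) (x : V), 0 <= l -> f (l *: x) = l *: f x.

Definition lpnorm {R : realType} (p : R) (n : nat) (a : 'I_n -> R) : R :=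
  (\sum_(j < n) `|a j| `^ p) `^ p^-1.

Section Dual.
Context {R : realType} (E : normedModType R).

Definition dual_pred : {pred E -> R} :=
  [pred f : E -> R | `[< scalar f /\ continuous f >]].

Lemma dual_submod_closed : submod_closed dual_pred.
Proof.
split=> [|a f g].
  apply/asboolP; split=> [k u v|x].
    by rewrite mulr0 addr0.
  exact: cst_continuous.
move=> /asboolP[lf cf] /asboolP[lg cg]; apply/asboolP; split=> [k u v|x].
  by rewrite !fctE lf lg /GRing.scale /= mulrDr addrACA mulrCA mulrDr.
apply: continuousD; last exact: cg.
by apply: continuousM; [exact: cst_continuous|exact: cf].
Qed.

HB.instance Definition _ :=
  GRing.isSubmodClosed.Build R (E -> R) dual_pred dual_submod_closed.

Record dual := Dual { dual_val :> E -> R; _ : dual_val \in dual_pred }.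

HB.instance Definition _ := [isSub for dual_val].
HB.instance Definition _ := [Choice of dual by <:].
HB.instance Definition _ := [SubChoice_isSubLmodule of dual by <:].

Definition dual_norm (x : dual) : \bar R :=
  opnorm (fun v : E => `|v|%:E) (fun r : R => `|r|%:E) x.

Definition dual_ball : set dual := [set x | (dual_norm x <= 1)%E].

(* [dual] itself carries no topology; [weak_star] is [dual] with the topology
   of pointwise convergence on E. *)
Definition weak_star : Type :=
  initial_topology (fun x : dual => (x : {ptws E -> R})).

HB.instance Definition _ := Topological.on weak_star.

End Dual.

Arguments dual_norm {R E} x.
Arguments dual_ball {R} E _.

(* Families are indexed by 'I_n with n = 0 allowed; the empty family only
   contributes the value 0 to the suprema below. *)
Definition weak_norm {R : realType} {E : normedModType R} (p : R) (n : nat)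
    (x : 'I_n -> dual E) : \bar R :=
  ereal_sup [set (lpnorm p (fun j => x j v))%:E | v in [set v : E | `|v| <= 1]].

Definition map_norm {R : realType} {E F : normedModType R} (p : R)
    (Phi : dual F -> dual E) : \bar R :=
  ereal_sup [set r | exists (m : nat) (y : 'I_m -> dual F),
    (weak_norm p y <= 1)%E /\ r = weak_norm p (fun j => Phi (y j))].

Section FreeBanachLattice.
Context {R : realType} (p : R) (E : normedModType R).

Definition delta (x : E) : dual E -> R := fun xs => xs x.

Definition fbl_norm (f : dual E -> R) : \bar R :=
  ereal_sup [set r | exists (n : nat) (x : 'I_n -> dual E),
    (weak_norm p x <= 1)%E /\ r = (lpnorm p (fun j => f (x j)))%:E].

Definition Hp : set (dual E -> R) :=
  [set f | pos_homogeneous f /\ (fbl_norm f < +oo)%E].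

Record closed_sublattice (S : set (dual E -> R)) : Prop := {
  closed_sublattice_Hp : S `<=` Hp;
  closed_sublattice0 : S 0;
  closed_sublatticeP : forall (a : R) f g, S f -> S g -> S (a *: f + g);
  closed_sublattice_max : forall f g, S f -> S g -> S (f \max g);
  closed_sublattice_min : forall f g, S f -> S g -> S (f \min g);
  closed_sublattice_closed : forall f, Hp f ->
    (forall e : R, 0 < e -> exists2 g, S g & (fbl_norm (f - g)%R < e%:E)%E) ->
    S f }.

Definition FBL_pred : {pred dual E -> R} :=
  [pred f | f \in smallest closed_sublattice (range delta)].

Lemma FBL_submod_closed : submod_closed FBL_pred.
Proof.
split=> [|a f g]; rewrite !inE; first by move=> S [/closed_sublattice0].
move=> Sf Sg S HS; apply: closed_sublatticeP; first by case: HS.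
  exact: Sf.
exact: Sg.
Qed.

HB.instance Definition _ :=
  GRing.isSubmodClosed.Build R (dual E -> R) FBL_pred FBL_submod_closed.

Record FBL := MkFBL { FBL_val :> dual E -> R; _ : FBL_val \in FBL_pred }.

HB.instance Definition _ := [isSub for FBL_val].
HB.instance Definition _ := [Choice of FBL by <:].
HB.instance Definition _ := [SubChoice_isSubLmodule of FBL by <:].

Lemma FBL_max_subproof (f g : FBL) : (f : dual E -> R) \max g \in FBL_pred.
Proof.
case: f g => f /= + [g /=]; rewrite !inE => Sf Sg S HS.
by apply: closed_sublattice_max; [case: HS|exact: Sf|exact: Sg].
Qed.

Lemma FBL_min_subproof (f g : FBL) : (f : dual E -> R) \min g \in FBL_pred.
Proof.
case: f g => f /= + [g /=]; rewrite !inE => Sf Sg S HS.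
by apply: closed_sublattice_min; [case: HS|exact: Sf|exact: Sg].
Qed.

Definition FBL_max (f g : FBL) : FBL := MkFBL (FBL_max_subproof f g).
Definition FBL_min (f g : FBL) : FBL := MkFBL (FBL_min_subproof f g).

End FreeBanachLattice.

Arguments fbl_norm {R} p {E} f.

Definition lattice_hom {R : realType} {p : R} {E F : normedModType R}
    (T : FBL p E -> FBL p F) : Prop :=
  [/\ linear T, {morph T : f g / FBL_max f g >-> FBL_max f g}
    & {morph T : f g / FBL_min f g >-> FBL_min f g}].

Definition FBL_opnorm {R : realType} {p : R} {E F : normedModType R}
    (T : FBL p E -> FBL p F) : \bar R :=
  opnorm (fun f : FBL p E => fbl_norm p f) (fun g : FBL p F => fbl_norm p g) T.

(* Main.v *)
From HB Require Import structures.
Require Import Defs.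
From mathcomp Require Import all_boot all_order all_algebra.
From mathcomp Require Import all_classical all_reals all_analysis.
From mathcomp Require Import ring lra.

Import Order.TTheory GRing.Theory Num.Theory.
Import numFieldNormedType.Exports.

Local Open Scope classical_set_scope.
Local Open Scope ring_scope.

(** For fixed [y] in the dual of [F], the functional [f |-> T f y] is a
    real-valued lattice homomorphism on [FBL p E], and the theorem amounts to
    the fact that every such functional [phi] is evaluation at a point
    ([lattice_functional_eval]).  The only candidate for that point is
    [v |-> phi (delta v)].

    For this to be a bounded functional, and for the identity
    [phi f = f x] to pass from the elements [delta v] to the closed sublattice
    they generate, [phi] has to be bounded, which is not assumed.  This is the
    automatic continuity of positive functionals on a Banach lattice
    ([pos_functional_bounded]): if [phi] is unbounded on the unit ball, there
    are positive [h n] of norm at most [2^-n] with [phi (h n) > n]; they have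
    a common upper bound [u] in the lattice ([FBL_dominated], the place where
    completeness enters), and [phi u > n] for all [n] is absurd.  The bound
    [u] is the pointwise supremum of the [h n]; it lies in [FBL p E] because
    it is the norm limit of the finite maxima of the [h n].

    Choosing the point for every [y] yields [Phi] with [T f = f \o Phi].  Since
    [Phi y v = T (delta v) y], the map [Phi] is unique, and it inherits
    positive homogeneity and weak*-continuity on the ball from the elements of
    [FBL p F]: these have both properties, as functions with these properties
    form a closed sublattice ([closed_sublattice_ball_continuous]; norm
    convergence is uniform on the dual ball).  The inequality
    [map_norm p Phi <= FBL_opnorm T] follows by testing [T] on [delta v] with
    [`|v| <= 1], and the converse by rescaling the families [Phi (y j)]. *)

(** * Finite-dimensional l^p norms *)

Section Lpnorm.
Context {R : realType} (p : R) (p1 : 1 <= p).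

Let p0 : 0 < p. Proof. exact: lt_le_trans p1. Qed.
Let pn0 : p != 0. Proof. by rewrite gt_eqF. Qed.

Lemma lpnorm_ge0 n (a : 'I_n -> R) : 0 <= lpnorm p a.
Proof. exact: powR_ge0. Qed.

Lemma lpnorm_le n (a : 'I_n -> R) (c : R) : 0 <= c ->
  lpnorm p a <= c <-> \sum_(j < n) `|a j| `^ p <= c `^ p.
Proof.
move=> c0; rewrite /lpnorm; set s := \sum_(_ < _) _.
have s0 : 0 <= s by apply: sumr_ge0 => j _; exact: powR_ge0.
have pV : 0 <= p^-1 by rewrite invr_ge0 ltW.
split=> h.
  rewrite -[s]powRr1// -(mulVf pn0) powRrM.
  by apply: ge0_ler_powR => //; rewrite ?nnegrE ?powR_ge0// ltW.
rewrite -[c]powRr1// -(mulfV pn0) powRrM.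
by apply: ge0_ler_powR => //; rewrite ?nnegrE ?powR_ge0.
Qed.

Lemma ler_lpnorm n (a b : 'I_n -> R) :
  (forall j, `|a j| <= `|b j|) -> lpnorm p a <= lpnorm p b.
Proof.
move=> ab; apply/lpnorm_le; first exact: lpnorm_ge0.
rewrite (@le_trans _ _ (\sum_(j < n) `|b j| `^ p))//; last first.
  by apply/lpnorm_le; first exact: lpnorm_ge0.
apply: ler_sum => j _; apply: ge0_ler_powR; rewrite ?nnegrE//; exact: ltW.
Qed.

Lemma lpnormZ n (k : R) (a : 'I_n -> R) :
  lpnorm p (fun j => k * a j) = `|k| * lpnorm p a.
Proof.
rewrite /lpnorm; under eq_bigr do rewrite normrM powRM//.
rewrite -mulr_sumr powRM ?powR_ge0//; last first.
  by apply: sumr_ge0 => j _; exact: powR_ge0.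
by rewrite -powRrM mulfV// powRr1.
Qed.

(** Minkowski's inequality, from the convexity of the [p]-th power. *)
Lemma lpnormD n (a b : 'I_n -> R) :
  lpnorm p (fun j => a j + b j) <= lpnorm p a + lpnorm p b.
Proof.
(* With strict upper bounds s and t one may divide by s, t and s + t. *)
suff key s t : lpnorm p a <= s -> lpnorm p b <= t -> 0 < s -> 0 < t ->
    lpnorm p (fun j => a j + b j) <= s + t.
  apply/ler_addgt0Pr => e e0.
  rewrite (le_trans (key (lpnorm p a + e / 2) (lpnorm p b + e / 2) _ _ _ _)) //.
  - by rewrite lerDl divr_ge0// ltW.
  - by rewrite lerDl divr_ge0// ltW.
  - by rewrite ltr_wpDl ?lpnorm_ge0// divr_gt0.
  - by rewrite ltr_wpDl ?lpnorm_ge0// divr_gt0.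
  - by rewrite addrACA -splitr.
move=> + + s0 t0; have st0 : 0 < s + t by rewrite addr_gt0.
have [sge0 tge0 stge0] := And3 (ltW s0) (ltW t0) (ltW st0).
move=> /(lpnorm_le _ _ _ sge0) Ha /(lpnorm_le _ _ _ tge0) Hb; apply/(lpnorm_le _ _ _ stge0).
have w0 : 0 <= s / (s + t) by rewrite divr_ge0// ltW.
have w1 : s / (s + t) <= 1 by rewrite ler_pdivrMr// mul1r lerDl ltW.
pose w : {i01 R} := Itv01 w0 w1.
have wE : 1 - s / (s + t) = t / (s + t).
  by rewrite -[X in X - _](mulfV (lt0r_neq0 st0)) -mulrBl addrAC subrr add0r.
have step j : `|a j + b j| `^ p <= (s + t) `^ p *
    (s / (s + t) * (`|a j| `^ p / s `^ p) + t / (s + t) * (`|b j| `^ p / t `^ p)).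
  have -> : `|a j| `^ p / s `^ p = (`|a j| / s) `^ p.
    by rewrite powRM ?invr_ge0 ?(ltW s0)// -(powR_inv1 (ltW s0)) -powRrM mulN1r powRN.
  have -> : `|b j| `^ p / t `^ p = (`|b j| / t) `^ p.
    by rewrite powRM ?invr_ge0 ?(ltW t0)// -(powR_inv1 (ltW t0)) -powRrM mulN1r powRN.
  have /= := @convex_powR R p p1 w (`|a j| / s) (`|b j| / t).
  rewrite !inE/= !in_itv/= !andbT !divr_ge0 ?(ltW s0) ?(ltW t0)//.
  move=> /(_ isT isT); rewrite !convRE/= => cv0.
  have cv : (s / (s + t) * (`|a j| / s) + t / (s + t) * (`|b j| / t)) `^ p <=
      s / (s + t) * (`|a j| / s) `^ p + t / (s + t) * (`|b j| / t) `^ p.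
    by rewrite -wE; exact: cv0.
  have st0' : 0 <= (s + t) `^ p by exact: powR_ge0.
  rewrite (le_trans _ (ler_wpM2l st0' cv))//.
  have -> : s / (s + t) * (`|a j| / s) + t / (s + t) * (`|b j| / t)
      = (`|a j| + `|b j|) / (s + t).
    by field; rewrite !gt_eqF.
  rewrite -powRM ?(ltW st0)//; last by rewrite divr_ge0 ?addr_ge0 ?(ltW st0).
  rewrite mulrC divfK ?gt_eqF//; apply: ge0_ler_powR; rewrite ?nnegrE ?addr_ge0 ?(ltW p0)//.
  exact: ler_normD.
apply: (le_trans (ler_sum _ (fun j _ => step j))).
rewrite -mulr_sumr ler_piMr ?powR_ge0// big_split/= -!mulr_sumr -!mulr_suml.
have sp : 0 < s `^ p by exact: powR_gt0.
have tp : 0 < t `^ p by exact: powR_gt0.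
apply: (@le_trans _ _ (s / (s + t) * 1 + t / (s + t) * 1)).
  apply: lerD; apply: ler_wpM2l; rewrite ?divr_ge0 ?(ltW st0) ?(ltW s0) ?(ltW t0)//.
  - by rewrite ler_pdivrMr// mul1r.
  - by rewrite ler_pdivrMr// mul1r.
by rewrite !mulr1 -mulrDl mulfV// gt_eqF.
Qed.

Lemma lpnorm1 (a : 'I_1 -> R) : lpnorm p a = `|a ord0|.
Proof. by rewrite /lpnorm big_ord1 -powRrM mulfV// powRr1. Qed.

End Lpnorm.

(** * Dual spaces *)

Section DualSpace.
Context {R : realType} {E : normedModType R}.
Implicit Types (x y : dual E) (v w : E).

Lemma dualZ (a : R) x v : (a *: x) v = a * x v.
Proof. by []. Qed.

Lemma dual0 x : x 0 = 0.
Proof.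
by case: x => f /= /asboolP[lf _]; have := lf (-1) 0 0; rewrite scaler0 add0r mulN1r addNr.
Qed.

Lemma dual_linear x (a : R) v w : x (a *: v + w) = a * x v + x w.
Proof. by case: x => f /= /asboolP[lf _]; exact: lf. Qed.

Lemma dual_scale x (a : R) v : x (a *: v) = a * x v.
Proof. by rewrite -[a *: v]addr0 dual_linear dual0 addr0. Qed.

Lemma dual_ext x y : (forall v, x v = y v) -> x = y.
Proof. by move=> xy; apply/val_inj/funext. Qed.

Lemma dual_continuous x : continuous (x : E -> R).
Proof. by case: x => f /= /asboolP[]. Qed.
 
Lemma dual_bounded x : exists2 c : R, 0 < c & forall v, `|x v| <= c * `|v|.
Proof.
have lx : linear (x : E -> R^o) by move=> a v w; exact: dual_linear.
pose fx : {linear E -> R^o} := HB.pack (x : E -> R^o) (GRing.isLinear.Build _ _ _ _ _ lx).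
have : continuous fx by exact: dual_continuous.
move=> /linear_bounded_continuous/linear_boundedP.
case/pinfty_ex_gt0 => r r0 Hr; exists r => //.
Qed.

Lemma dual_of_bounded (f : E -> R) (c : R) :
    (forall a v w, f (a *: v + w) = a * f v + f w) ->
  (forall v, `|f v| <= c * `|v|) -> exists x : dual E, forall v, x v = f v.
Proof.
move=> lf fc.
have lx : linear (f : E -> R^o) by [].
pose fx : {linear E -> R^o} := HB.pack (f : E -> R^o) (GRing.isLinear.Build _ _ _ _ _ lx).
have cf : continuous fx.
  apply/linear_bounded_continuous/linear_boundedP.
  exists c; split; first exact: num_real.
  by move=> r cr v; apply: le_trans (fc v) _; apply: ler_wpM2r => //; exact: ltW.
suff df : f \in @dual_pred R E by exists (Dual df).
by apply/asboolP; split.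
Qed.

Lemma dual_norm_le x (c : R) : (dual_norm x <= c%:E)%E <->
  (forall v, `|v| <= 1 -> `|x v| <= c).
Proof.
split=> [xc v v1|xc].
  rewrite -lee_fin; apply: le_trans xc; apply: ereal_sup_ubound.
  by exists v => //=; rewrite lee_fin.
apply: ge_ereal_sup => _ [v /= + <-]; rewrite !lee_fin; exact: xc.
Qed.

Lemma dual_norm_fin x : exists2 c : R, 0 < c & (dual_norm x <= c%:E)%E.
Proof.
have [c c0 xc] := dual_bounded x; exists c => //.
apply/dual_norm_le => v v1; apply: le_trans (xc v) _.
by rewrite ler_piMr// ltW.
Qed.

End DualSpace.

(** * The free norm and the weak*-topology *)

Section FblNorm.
Context {R : realType} (p : R) (p1 : 1 <= p) {E : normedModType R}.
Implicit Types (f g : dual E -> R) (v : E).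

Lemma weak_norm_le n (x : 'I_n -> dual E) (c : R) :
  (weak_norm p x <= c%:E)%E <->
  (forall v, `|v| <= 1 -> lpnorm p (fun j => x j v) <= c).
Proof.
split=> [xc v v1|xc].
  by rewrite -lee_fin; apply: le_trans xc; apply: ereal_sup_ubound; exists v.
by apply: ge_ereal_sup => _ [v v1 <-]; rewrite lee_fin; exact: xc.
Qed.

Lemma lpnorm_weak n (x : 'I_n -> dual E) (c : R) v :
  (weak_norm p x <= c%:E)%E -> lpnorm p (fun j => x j v) <= c * `|v|.
Proof.
move=> /weak_norm_le xc; have [->|v0] := eqVneq v 0.
  rewrite normr0 mulr0; apply/(lpnorm_le p p1) => //.
  rewrite powR0 ?gt_eqF ?(lt_le_trans _ p1)// big1// => j _.
  by rewrite dual0 normr0 powR0// gt_eqF// (lt_le_trans _ p1).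
have nv : 0 < `|v| by rewrite normr_gt0.
have /xc : `| `|v|^-1 *: v| <= 1 by rewrite normrZ normfV normr_id mulVf ?gt_eqF.
have -> : (fun j => x j (`|v|^-1 *: v)) = (fun j => `|v|^-1 * x j v).
  by apply/funext => j; rewrite dual_scale.
by rewrite (lpnormZ p p1) normfV normr_id ler_pdivrMl// mulrC.
Qed.

Lemma fbl_norm_ubound f n (x : 'I_n -> dual E) : (weak_norm p x <= 1)%E ->
  ((lpnorm p (fun j => f (x j)))%:E <= fbl_norm p f)%E.
Proof. by move=> x1; apply: ereal_sup_ubound; exists n, x. Qed.

Lemma fbl_norm_le f (c : \bar R) : (forall n (x : 'I_n -> dual E),
    (weak_norm p x <= 1)%E -> ((lpnorm p (fun j => f (x j)))%:E <= c)%E) ->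
  (fbl_norm p f <= c)%E.
Proof. by move=> fc; apply: ge_ereal_sup => _ [n [x [x1 ->]]]; exact: fc. Qed.

Lemma weak_norm_nil (x : 'I_0 -> dual E) : (weak_norm p x <= 1)%E.
Proof.
by apply/weak_norm_le => v _; rewrite /lpnorm big_ord0 powR0// invr_eq0 gt_eqF// (lt_le_trans _ p1).
Qed.

Lemma fbl_norm_ge0 f : (0 <= fbl_norm p f)%E.
Proof.
apply: le_trans (fbl_norm_ubound f 0 (fun=> 0) (weak_norm_nil _)).
by rewrite lee_fin lpnorm_ge0.
Qed.

Lemma ler_fbl_norm f g : (forall x, `|f x| <= `|g x|) ->
  (fbl_norm p f <= fbl_norm p g)%E.
Proof.
move=> fg; apply: fbl_norm_le => n x x1.
apply: le_trans (fbl_norm_ubound g n x x1).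
by rewrite lee_fin; apply: (ler_lpnorm p p1).
Qed.

Lemma fbl_normD f g (a b : R) : (fbl_norm p f <= a%:E)%E ->
  (fbl_norm p g <= b%:E)%E -> (fbl_norm p (f + g)%R <= (a + b)%:E)%E.
Proof.
move=> fa gb; apply: fbl_norm_le => n x x1; rewrite lee_fin.
apply: (le_trans (lpnormD p p1 n (fun j => f (x j)) (fun j => g (x j)))).
by apply: lerD; rewrite -lee_fin; apply: le_trans (fbl_norm_ubound _ n x x1) _.
Qed.

Lemma fbl_normZ (k : R) f (a : R) : (fbl_norm p f <= a%:E)%E ->
  (fbl_norm p (k *: f)%R <= (`|k| * a)%:E)%E.
Proof.
move=> fa; apply: fbl_norm_le => n x x1; rewrite lee_fin.
rewrite [leLHS](lpnormZ p p1 n k (fun j => f (x j))) ler_wpM2l//.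
by rewrite -lee_fin; apply: le_trans (fbl_norm_ubound _ n x x1) _.
Qed.

Lemma fbl_norm_delta v : (fbl_norm p (delta v) <= `|v|%:E)%E.
Proof.
by apply: fbl_norm_le => n x x1; rewrite lee_fin -[leRHS]mul1r; exact: lpnorm_weak.
Qed.

(** A one-element family has weak norm equal to the dual norm of its member,
    so evaluation at [x] is bounded by [dual_norm x] for the free norm. *)
Lemma poshom_eval_le f (x : dual E) (c M : R) : pos_homogeneous f ->
    0 < c -> (dual_norm x <= c%:E)%E -> (fbl_norm p f <= M%:E)%E ->
  `|f x| <= c * M.
Proof.
move=> hf c0 xc fM.
have w : (weak_norm p (fun _ : 'I_1 => (c^-1 *: x)%R) <= 1)%E.
  apply/weak_norm_le => v v1; rewrite (lpnorm1 p p1) dualZ normrM normfV.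
  rewrite (gtr0_norm c0) ler_pdivrMl// mulr1; move/dual_norm_le : xc; exact.
have := le_trans (fbl_norm_ubound f 1 _ w) fM.
rewrite lee_fin (lpnorm1 p p1) hf ?invr_ge0 ?(ltW c0)//.
rewrite [_ *: _]/(_ * _) normrM normfV (gtr0_norm c0).
by rewrite ler_pdivrMl.
Qed.

Lemma Hp_fin f : Hp p f -> exists2 M : R, 0 <= M & (fbl_norm p f <= M%:E)%E.
Proof.
move=> [_ ffin]; have f0 := fbl_norm_ge0 f.
exists (fine (fbl_norm p f)); first exact: fine_ge0.
by rewrite fineK// ge0_fin_numE.
Qed.

Lemma Hp_lin (a : R) f g : Hp p f -> Hp p g -> Hp p (a *: f + g).
Proof.
move=> Hf Hg; have [M _ fM] := Hp_fin f Hf; have [N _ gN] := Hp_fin g Hg.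
split; last by apply: le_lt_trans (fbl_normD _ _ _ _ (fbl_normZ a f M fM) gN) (ltry _).
move=> l x l0; rewrite !fctE [_ l _]/GRing.scale/= (proj1 Hf)// (proj1 Hg)//.
by rewrite /GRing.scale/= mulrDr mulrCA.
Qed.

Lemma fbl_norm_abs f : fbl_norm p (fun x => `|f x|) = fbl_norm p f.
Proof.
by apply/eqP; rewrite eq_le; apply/andP; split; apply: ler_fbl_norm => x; rewrite normr_id.
Qed.

Lemma Hp_minmax f g : Hp p f -> Hp p g -> Hp p (f \max g) /\ Hp p (f \min g).
Proof.
move=> Hf Hg; have [M _ fM] := Hp_fin f Hf; have [N _ gN] := Hp_fin g Hg.
have fin h : (forall x, `|h x| <= `|f x| + `|g x|) -> (fbl_norm p h < +oo)%E.
  move=> hfg; apply: le_lt_trans (ltry (M + N)).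
  have fgM : (fbl_norm p ((fun x => `|f x|) + (fun x => `|g x|))%R <= (M + N)%:E)%E.
    by apply: fbl_normD; rewrite fbl_norm_abs.
  apply: le_trans fgM; apply: ler_fbl_norm => x; rewrite !fctE.
  by rewrite [leRHS]ger0_norm ?addr_ge0.
split; split.
- move=> l x l0; rewrite /= (proj1 Hf)// (proj1 Hg)//.
  by rewrite /GRing.scale/= maxr_pMr.
- apply: fin => x /=; case: (lerP (f x) (g x)) => _; [by rewrite lerDr|by rewrite lerDl].
- move=> l x l0; rewrite /= (proj1 Hf)// (proj1 Hg)//.
  by rewrite /GRing.scale/= minr_pMr.
- apply: fin => x /=; case: (lerP (f x) (g x)) => _; [by rewrite lerDl|by rewrite lerDr].
Qed.

Lemma weak_star_eval_continuous v : continuous (fun x : weak_star E => x v).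
Proof.
move=> x.
have := @initial_continuous _ {ptws E -> R} (fun x : dual E => (x : {ptws E -> R})) x.
move=> h; have c := @proj_continuous E (fun=> R) v.
exact: (continuous_comp h (c _)).
Qed.

Lemma continuous_weak_star (X : topologicalType) (f : X -> weak_star E) :
 
  (forall v, continuous (fun z => f z v)) -> continuous f.
Proof.
move=> cf; apply: continuous_comp_initial => z.
have [_] := @pointwise_cvgP E R (fmap (fun z => (f z : E -> R)) (nbhs z)) (f z) _.
by apply => v; exact: (cf v z).
Qed.

Let ballE : set (weak_star E) := dual_ball E.

Let three_eps (a b c d e : R) :
  `|a - c| <= e / 3 -> `|b - d| <= e / 3 -> `|c - d| < e / 3 -> `|a - b| < e.
Proof.
rewrite !ler_norml !ltr_norml => /andP[? ?] /andP[? ?] /andP[? ?].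
by apply/andP; split; lra.
Qed.

(** Closedness under limits holds because the free norm dominates the
    supremum norm on the dual ball. *)
Lemma closed_sublattice_ball_continuous : closed_sublattice p
  [set f | Hp p f /\ {within ballE, continuous (f : weak_star E -> R)}].
Proof.
split.
- by move=> f [].
- split; last by apply: continuous_subspaceT => x; exact: cst_continuous.
  split; first by move=> l x _; rewrite scaler0.
  apply: le_lt_trans (ltry 0); apply: fbl_norm_le => n x _.
  rewrite lee_fin; apply/(lpnorm_le p p1) => //; rewrite big1 ?powR_ge0// => j _.
  by rewrite normr0 powR0// gt_eqF// (lt_le_trans _ p1).
- move=> a f g [Hf cf] [Hg cg]; split; first exact: Hp_lin.
  move=> x; apply: continuousD; last exact: cg.
  by apply: continuousM; [exact: cst_continuous|exact: cf].
- move=> f g [Hf cf] [Hg cg]; split; first by case: (Hp_minmax f g Hf Hg).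
  by move=> x; apply: continuous_max; [exact: cf|exact: cg].
- move=> f g [Hf cf] [Hg cg]; split; first by case: (Hp_minmax f g Hf Hg).
  by move=> x; apply: continuous_min; [exact: cf|exact: cg].
move=> f Hf apx; split => //; apply/subspace_continuousP => x Bx.
apply/cvgrPdist_lt => e e0.
have [g [Hg cg] fg] := apx _ (divr_gt0 e0 (ltr0n _ 3)).
have close y : ballE y -> `|f y - g y| <= e / 3.
  move=> By; rewrite -[leRHS]mul1r.
  have Hfg : Hp p (f - g) by rewrite addrC -scaleN1r; exact: Hp_lin.
  exact: (poshom_eval_le (f - g) y 1 (e / 3) (proj1 Hfg) ltr01 By (ltW fg)).
move/subspace_continuousP : cg => /(_ x Bx)/cvgrPdist_lt/(_ _ (divr_gt0 e0 (ltr0n _ 3))).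
rewrite !near_withinE; apply: filterS => y gy By.
exact: (three_eps _ _ _ _ _ (close x Bx) (close y By) (gy By)).
Qed.

End FblNorm.

(** * Positive functionals and lattice homomorphisms on the free Banach lattice *)

Section FreeLattice.
Context {R : realType} (p : R) (p1 : 1 <= p) {E : normedModType R}.
Implicit Types (f g : FBL p E) (v : E).

(** Induction along the generation of the free Banach lattice. *)
Lemma FBL_ind (S : set (dual E -> R)) : closed_sublattice p S ->
  (forall v, S (delta v)) -> forall f, S f.
Proof.
move=> HS Sd [f /=]; rewrite inE; apply; split => // _ [v _ <-]; exact: Sd.
Qed.

Lemma FBL_ball_continuous f : Hp p f /\
  {within (dual_ball E : set (weak_star E)), continuous (f : weak_star E -> R)}.
Proof.
apply: (FBL_ind _ (closed_sublattice_ball_continuous p p1)) => v; split.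
  split; first by move=> l x _.
  exact: le_lt_trans (fbl_norm_delta p p1 v) (ltry _).
by apply: continuous_subspaceT; exact: weak_star_eval_continuous.
Qed.

Lemma FBL_Hp f : Hp p f.
Proof. by case: (FBL_ball_continuous f). Qed.

Lemma delta_FBL v : delta v \in @FBL_pred R p E.
Proof. by rewrite inE => S [_]; apply; exists v. Qed.

(** The evaluation [delta v] as an element of [FBL p E]. *)
Definition FBL_delta v : FBL p E := MkFBL (delta_FBL v).

Lemma FBL_ext f g : (forall x, f x = g x) -> f = g.
Proof. by move=> fg; apply/val_inj/funext. Qed.

Section Domination.
Context (h : nat -> FBL p E) (h_ge0 : forall n x, 0 <= h n x)
  (h_norm : forall n, (fbl_norm p (h n) <= (2^-1 ^+ n)%:E)%E).

(* The pointwise supremum of the sequence h. *)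
Let g (x : dual E) : R := sup (range (fun n => h n x)).

Let h_bounded x : has_sup (range (fun n => h n x)).
Proof.
split; first by exists (h 0%N x); exists 0%N.
have [c c0 xc] := dual_norm_fin x.
exists c => _ [n _ <-]; apply: le_trans (ler_norm _) _.
apply: (le_trans (poshom_eval_le p p1 _ _ _ _ (proj1 (FBL_Hp (h n))) c0 xc (h_norm n))).
by rewrite ler_piMr ?(ltW c0)// exprn_ile1// ?invr_ge0// invf_le1// ler1n.
Qed.

Let h_le_g n x : h n x <= g x.
Proof. by apply: ub_le_sup; [case: (h_bounded x)|exists n]. Qed.

Let g_le x b : (forall n, h n x <= b) -> g x <= b.
Proof.
move=> hb; apply: ge_sup; first by case: (h_bounded x).
by move=> _ [n _ <-]; exact: hb.
Qed.

Let g_poshom : pos_homogeneous g.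
Proof.
move=> l x; rewrite le_eqVlt => /predU1P[<-|l0].
  have hn0 n : h n (0 *: x) = 0.
    by rewrite (proj1 (FBL_Hp (h n)))// /GRing.scale/= mul0r.
  apply/eqP; rewrite [_ *: g x]mul0r eq_le; apply/andP; split.
    by apply: g_le => n; rewrite hn0.
  by have := h_le_g 0%N (0 *: x); rewrite hn0.
have hs n : h n (l *: x) = l * h n x by rewrite (proj1 (FBL_Hp (h n)))// ltW.
apply/eqP; rewrite eq_le; apply/andP; split.
  by apply: g_le => n; rewrite hs ler_pM2l.
rewrite [_ *: g x]/(_ * _) -ler_pdivlMl//; apply: g_le => n.
by rewrite ler_pdivlMl// -hs; exact: h_le_g.
Qed.

(* The finite maxima of h 0, ..., h n. *)
Let m := fix m n : FBL p E :=
  if n is k.+1 then FBL_max (m k) (h k.+1) else h 0%N.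

Let h_le_m n k x : (k <= n)%N -> h k x <= m n x.
Proof.
elim: n => [|n IH] /=; first by rewrite leqn0 => /eqP ->.
rewrite leq_eqVlt ltnS => /predU1P[->|/IH kn]; rewrite le_max ?kn//.
by rewrite lexx orbT.
Qed.

Let m_le_g n x : m n x <= g x.
Proof. by elim: n => [|n IH] /=; rewrite ?ge_max ?IH h_le_g. Qed.

(* The sum of the K terms of h that follow h n. *)
Let tail n K : dual E -> R := \sum_(i < K) (h (n.+1 + i)%N : dual E -> R).

Let tailE n K x : tail n K x = \sum_(i < K) h (n.+1 + i)%N x.
Proof. by rewrite /tail fct_sumE. Qed.

Let tail_norm n K :
  (fbl_norm p (tail n K) <= (2^-1 ^+ n - 2^-1 ^+ (n + K))%:E)%E.
Proof.
elim: K => [|K IH].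
  rewrite addn0 subrr /tail big_ord0.
  have := fbl_normZ p p1 0 (h 0%N) _ (h_norm 0%N).
  by rewrite scale0r normr0 mul0r.
rewrite /tail big_ord_recr.
apply: le_trans (fbl_normD p p1 _ _ _ _ IH (h_norm _)) _.
by rewrite lee_fin addnS addSn !exprS; lra.
Qed.

(* If g x > m n x, some term h k x exceeds the midpoint of the two values;
   then k > n, and the gap g x - m n x is less than 2 * h k x. *)
Let g_near n x : exists K0, forall K, (K0 <= K)%N ->
  g x - m n x <= 2 * tail n K x.
Proof.
have tail_ge0 K : 0 <= tail n K x by rewrite tailE sumr_ge0.
have [d0|d0] := lerP (g x - m n x) 0.
  by exists 0%N => K _; apply: le_trans d0 _; rewrite mulr_ge0.
have [_ [k _ <-] hk] := sup_adherent (divr_gt0 d0 (ltr0n R 2)) (h_bounded x).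
have nk : (n < k)%N.
  by rewrite ltnNge; apply/negP => /(h_le_m n k x); move: hk; rewrite -/(g x); lra.
have m0 : 0 <= m n x by apply: le_trans (h_ge0 0%N x) (h_le_m n 0%N x (leq0n _)).
exists (k - n)%N => K kK.
have : h k x <= tail n K x.
  have iK : (k - n.+1 < K)%N.
    by apply: leq_trans kK; rewrite ltn_sub2l.
  rewrite tailE (bigD1 (Ordinal iK))//= subnKC// lerDl.
  exact: sumr_ge0.
by move: hk; rewrite -/(g x); lra.
Qed.

Let g_approx n : (fbl_norm p (g - (m n : dual E -> R))%R <= (2 * 2^-1 ^+ n)%:E)%E.
Proof.
apply: fbl_norm_le => N x x1.
(* One K serves the finitely many points of the family at once. *)
have [K_ HK] := choice (fun j => g_near n (x j)).
pose K := (\max_j K_ j)%N.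
have tn := fbl_normZ p p1 2 _ _ (tail_norm n K).
apply: (@le_trans _ _ (lpnorm p (fun j => (2 *: tail n K) (x j)))%:E).
  rewrite lee_fin; apply: (ler_lpnorm p p1) => j.
  rewrite !fctE [_ *: _]/(_ * _) ger0_norm ?subr_ge0//.
  by apply: le_trans (ler_norm _); apply: HK; exact: leq_bigmax.
apply: le_trans (fbl_norm_ubound p _ _ _ x1) _.
apply: le_trans tn _; rewrite lee_fin ger0_norm// ler_wpM2l// gerBl.
by rewrite exprn_ge0// invr_ge0.
Qed.

Let g_Hp : Hp p g.
Proof.
split; first exact: g_poshom.
have -> : g = (g - (m 0%N : dual E -> R)) + (h 0%N : dual E -> R) by rewrite subrK.
exact: le_lt_trans (fbl_normD p p1 _ _ _ _ (g_approx 0) (h_norm 0%N)) (ltry _).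
Qed.

(** A positive sequence in the free Banach lattice whose norms decay
    geometrically is order bounded. *)
Lemma FBL_dominated : exists u : FBL p E, forall n x, h n x <= u x.
Proof.
suff Fg : g \in @FBL_pred R p E by exists (MkFBL Fg).
rewrite inE => S [HS Sd]; apply: (closed_sublattice_closed HS) => // e e0.
have [n ne] : exists n, 2 * 2^-1 ^+ n < e.
  have e2 : 0 < e / 2 by rewrite divr_gt0.
  have := @cvg_geometric R 1 2^-1.
  rewrite ger0_norm ?invr_ge0// invf_lt1// ltr1n => /(_ isT).
  move=> /cvgrPdist_lt/(_ _ e2)[n _ /(_ n (leqnn n))].
  rewrite /= sub0r normrN mul1r ger0_norm ?exprn_ge0 ?invr_ge0// => ne.
  by exists n; rewrite mulrC -ltr_pdivlMr.
exists (m n); last by apply: le_lt_trans (g_approx n) _; rewrite lte_fin.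
by apply: (FBL_ind S HS) => v; apply: Sd; exists v.
Qed.

End Domination.

Section Functional.
Context (phi : FBL p E -> R)
  (phi_lin : forall (a : R) f g, phi (a *: f + g) = a * phi f + phi g).

Let phi0 : phi 0 = 0.
Proof. by have := phi_lin (-1) 0 0; rewrite scaler0 add0r; lra. Qed.

Let phiZ (a : R) f : phi (a *: f) = a * phi f.
Proof. by have := phi_lin a f 0; rewrite addr0 phi0 addr0. Qed.

Let phiB f g : phi (f - g) = phi f - phi g.
Proof. by rewrite addrC -scaleN1r phi_lin; lra. Qed.

(** Automatic continuity of positive functionals. *)
Lemma pos_functional_bounded : (forall f, (forall x, 0 <= f x) -> 0 <= phi f) ->
  exists2 C : R, 0 < C &
    forall f (M : R), (fbl_norm p f <= M%:E)%E -> `|phi f| <= C * M.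
Proof.
move=> pos.
have mono f g : (forall x, f x <= g x) -> phi f <= phi g.
  by move=> fg; rewrite -subr_ge0 -phiB; apply: pos => x; have := fg x; rewrite -subr_ge0.
suff [C HC] : exists C : R, forall f, (fbl_norm p f <= 1)%E -> `|phi f| <= C.
  exists (`|C| + 1); first by rewrite ltr_wpDl.
  (* M may be 0, so f is divided by a slightly larger N > 0. *)
  move=> f M fM.
  have M0 : 0 <= M by rewrite -lee_fin; apply: le_trans fM; exact: fbl_norm_ge0.
  apply/ler_addgt0Pr => e e0; set D := `|C| + 1.
  have D0 : 0 < D by rewrite ltr_wpDl.
  pose N := M + e / D.
  have N0 : 0 < N by rewrite ltr_wpDl// divr_gt0.
  have -> : D * M + e = D * N by rewrite /N; field; rewrite gt_eqF.
  have fN : (fbl_norm p (N^-1 *: f : FBL p E) <= 1)%E.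
    apply: le_trans (fbl_normZ p p1 _ _ _ fM) _.
    rewrite lee_fin gtr0_norm ?invr_gt0// ler_pdivrMl// mulr1 lerDl.
    by rewrite divr_ge0// ltW.
  have := HC _ fN; rewrite phiZ normrM gtr0_norm ?invr_gt0// ler_pdivrMl// mulrC => H.
  apply: le_trans H _; rewrite ler_wpM2r ?(ltW N0)//.
  by apply: le_trans (ler_norm _) _; rewrite lerDl.
apply: contrapT => /forallNP unb.
have ex n : exists f, (fbl_norm p f <= 1)%E /\ n%:R * 2 ^+ n < `|phi f|.
  have := unb (n%:R * 2 ^+ n). move=> /existsNP[f]. move=> /not_implyP[f1 /negP].
  by rewrite -ltNge => ?; exists f.
have [f_ Hf] := choice ex.
pose a n : FBL p E := FBL_max (f_ n) (- f_ n).
have aE n x : a n x = `|f_ n x|.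
  by rewrite /a /= /Num.norm/=; exact: maxrN.
pose h n : FBL p E := 2^-1 ^+ n *: a n.
have h0 n x : 0 <= h n x.
  by rewrite [h n x]/(_ * a n x) aE mulr_ge0// exprn_ge0// invr_ge0.
have hn n : (fbl_norm p (h n) <= (2^-1 ^+ n)%:E)%E.
  have an : (fbl_norm p (a n) <= 1%:E)%E.
    apply: le_trans (proj1 (Hf n)); apply: ler_fbl_norm => // x.
    by rewrite aE normr_id.
  apply: le_trans (fbl_normZ p p1 _ _ _ an) _.
  by rewrite mulr1 ger0_norm// exprn_ge0// invr_ge0.
have [u hu] := FBL_dominated h h0 hn.
have un n : n%:R < phi u.
  apply: (@lt_le_trans _ _ (phi (h n))); last exact: mono.
  rewrite phiZ exprVn ltr_pdivlMl ?exprn_gt0// mulrC.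
  apply: lt_le_trans (proj2 (Hf n)) _; rewrite ler_norml; apply/andP; split.
    rewrite lerNl -[- phi _]mulN1r -phiZ; apply: mono => x.
    by rewrite aE scaleN1r -normrN ler_norm.
  by apply: mono => x; rewrite aE ler_norm.
have u0 : 0 <= phi u by apply: ltW; exact: (un 0%N).
by have := lt_trans (archi_boundP u0) (un (Num.bound (phi u))); rewrite ltxx.
Qed.

(** Real-valued lattice homomorphisms on the free Banach lattice are point
    evaluations. *)
Lemma lattice_functional_eval :
    (forall f g, phi (FBL_max f g) = Num.max (phi f) (phi g)) ->
    (forall f g, phi (FBL_min f g) = Num.min (phi f) (phi g)) ->
  exists x : dual E, forall f, phi f = f x.
Proof.
move=> phi_max phi_min.
have [f f0|C C0 HC] := pos_functional_bounded.
  have -> : f = FBL_max f 0.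
    by apply: FBL_ext => x /=; apply/esym/max_l; exact: f0.
  by rewrite phi_max phi0 le_max lexx orbT.
have [|v|x Hx] := dual_of_bounded (fun v => phi (FBL_delta v)) C.
- move=> a v w; rewrite -phi_lin; congr phi; apply: FBL_ext => x.
  exact: dual_linear.
- by apply: HC; exact: fbl_norm_delta.
exists x => f.
(* The elements on which phi agrees with evaluation at x. *)
pose S : set (dual E -> R) :=
  [set f | exists Hf : f \in @FBL_pred R p E, phi (MkFBL Hf) = f x].
have SP (g : FBL p E) : phi g = g x -> S g.
  by case: g => g Hg /= gx; exists Hg.
suff : S f.
  by case=> Hf <-; congr phi; exact: FBL_ext.
apply: FBL_ind => [|v]; last by apply: (SP (FBL_delta v)); rewrite -Hx.
split.
- by move=> g [Hg _]; exact: (FBL_Hp (MkFBL Hg)).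
- exact: (SP 0).
- move=> a g k [Hg gx] [Hk kx]; apply: (SP (a *: MkFBL Hg + MkFBL Hk)).
  by rewrite phi_lin gx kx.
- move=> g k [Hg gx] [Hk kx]; apply: (SP (FBL_max (MkFBL Hg) (MkFBL Hk))).
  by rewrite phi_max gx kx.
- move=> g k [Hg gx] [Hk kx]; apply: (SP (FBL_min (MkFBL Hg) (MkFBL Hk))).
  by rewrite phi_min gx kx.
move=> g Hpg apx.
have Hg : g \in @FBL_pred R p E.
  rewrite inE => U [HU Ud]; apply: (closed_sublattice_closed HU) => // e e0.
  have [k [Hk _] gk] := apx e e0; exists k => //.
  by apply: (FBL_ind U HU _ (MkFBL Hk)) => v; apply: Ud; exists v.
apply: (SP (MkFBL Hg)); apply/eqP; rewrite -subr_eq0 -normr_le0.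
have [c c0 xc] := dual_norm_fin x.
apply/ler_addgt0Pr => e e0; rewrite add0r.
have Cc : 0 < C + c by rewrite addr_gt0.
have [k [Hk kx] gk] := apx _ (divr_gt0 e0 Cc).
have := HC (MkFBL Hg - MkFBL Hk) _ (ltW gk).
have := poshom_eval_le p p1 _ _ _ _
  (proj1 (FBL_Hp (MkFBL Hg - MkFBL Hk))) c0 xc (ltW gk).
rewrite phiB kx [_ x]/(g x - k x) => H1 H2.
have -> : e = C * (e / (C + c)) + c * (e / (C + c)).
  by rewrite -mulrDl mulrC divfK// gt_eqF.
apply: le_trans (lerD H2 H1).
rewrite [X in X <= _](_ : _ = `|(phi (MkFBL Hg) - k x) - (g x - k x)|).
  exact: ler_normB.
by congr `|_|; rewrite /=; lra.
Qed.

End Functional.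
End FreeLattice.

(** * Composition operators *)

Section Composition.
Context {R : realType} (p : R) (p1 : 1 <= p) {E F : normedModType R}
  (T : FBL p E -> FBL p F) (Phi : dual F -> dual E)
  (TE : forall f y, T f y = f (Phi y)).

Lemma composition_pos_homogeneous : pos_homogeneous Phi.
Proof.
move=> l y l0; apply: dual_ext => v.
have := proj1 (FBL_Hp p p1 (T (FBL_delta p v))) l y l0.
by rewrite !TE.
Qed.

Lemma composition_norm : map_norm p Phi = FBL_opnorm T.
Proof.
apply/eqP; rewrite eq_le; apply/andP; split; apply: ge_ereal_sup.
  move=> _ [n [y [y1 ->]]]; apply: ge_ereal_sup => _ [v /= v1 <-].
  have -> : (fun j => Phi (y j) v) = (fun j => T (FBL_delta p v) (y j)).
    by apply/funext => j; rewrite TE.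
  apply: le_trans (fbl_norm_ubound p _ _ y y1) _.
  apply: ereal_sup_ubound; exists (FBL_delta p v) => //=.
  by apply: le_trans (fbl_norm_delta p p1 v) _; rewrite lee_fin.
move=> _ [f /= f1 <-]; apply: fbl_norm_le => n y y1.
have : (weak_norm p (fun j => Phi (y j)) <= map_norm p Phi)%E.
  by apply: ereal_sup_ubound; exists n, y.
have : (0 <= map_norm p Phi)%E.
  apply: (@le_trans _ _ (weak_norm p (fun j : 'I_0 => Phi 0))).
    apply: ereal_sup_ge; exists (lpnorm p (fun j : 'I_0 => Phi 0 0))%:E.
      by exists 0; rewrite //= normr0.
    by rewrite lee_fin lpnorm_ge0.
  apply: ereal_sup_ubound; exists 0%N, (fun=> 0).
  by split => //; exact: weak_norm_nil.
case: (map_norm p Phi) => [c|_ _|//]; last by rewrite leey.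
rewrite lee_fin => c0 yc; rewrite lee_fin; apply/ler_addgt0Pr => e e0.
(* c may be 0, so the family is rescaled by c + e > 0. *)
have ce0 : 0 < c + e by rewrite ltr_wpDl.
have w1 : (weak_norm p (fun j => ((c + e)^-1 *: Phi (y j))%R) <= 1)%E.
  apply/weak_norm_le => v v1.
  rewrite (lpnormZ p p1 n _ (fun j => Phi (y j) v)) gtr0_norm ?invr_gt0//.
  rewrite ler_pdivrMl// mulr1.
  move/weak_norm_le : yc => /(_ v v1) yc.
  by apply: le_trans yc _; rewrite lerDl ltW.
have := le_trans (fbl_norm_ubound p f _ _ w1) f1.
have -> : (fun j => f ((c + e)^-1 *: Phi (y j))) =
    (fun j => (c + e)^-1 * T f (y j)).
  apply/funext => j; rewrite TE (proj1 (FBL_Hp p p1 f))// invr_ge0.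
  exact: ltW.
rewrite lee_fin (lpnormZ p p1 n _ (fun j => T f (y j))).
by rewrite gtr0_norm ?invr_gt0// ler_pdivrMl// mulr1.
Qed.

Lemma composition_weak_star_continuous :
  {within (dual_ball F : set (weak_star F)),
    continuous (Phi : weak_star F -> weak_star E)}.
Proof.
apply: continuous_weak_star => v.
have -> : (fun z => Phi z v) = T (FBL_delta p v) by apply/funext => z; rewrite TE.
by case: (FBL_ball_continuous p p1 (T (FBL_delta p v))).
Qed.

End Composition.

Theorem theorem6p4 (R : realType) (p : R) (E F : completeNormedModType R)
    (T : FBL p E -> FBL p F) :
  1 <= p -> lattice_hom T ->
  exists Phi : dual F -> dual E,
    [/\ unique (fun Psi : dual F -> dual E =>
          forall f : FBL p E, T f = f \o Psi :> (dual F -> R)) Phi,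
        pos_homogeneous Phi,
        map_norm p Phi = FBL_opnorm T
      & {within (dual_ball F : set (weak_star F)),
           continuous (Phi : weak_star F -> weak_star E)}].
Proof.
move=> p1 [Tlin Tmax Tmin].
have [y|Phi TE] := @choice (dual F) (dual E) (fun y x => forall f : FBL p E, T f y = f x).
  apply: (lattice_functional_eval p p1 (fun f => T f y)).
  - by move=> a f g; rewrite Tlin.
  - by move=> f g; rewrite Tmax.
  - by move=> f g; rewrite Tmin.
have TE' f y : T f y = f (Phi y) by exact: TE.
exists Phi; split.
- split=> [f|Psi PsiE]; first by apply/funext => y; exact: TE.
  apply/funext => y; apply: dual_ext => v.
  have := TE y (FBL_delta p v); rewrite PsiE; exact: esym.
- exact: composition_pos_homogeneous TE'.
- exact: composition_norm TE'.
- exact: composition_weak_star_continuous TE'.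
Qed.
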